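(* Let $(X,d)$ be a complete metric space and suppose that $d_0^n=d_0^{n+1}$ for some $n\in\mathbb{N}$. Then $d_0^m=\bar d$ for all $m\ge n$.
   Context: Metrics are allowed to take the value $\infty$ (all other metric axioms are as usual; topology, completeness, etc. are defined as usual). Here $\mathbb{N}$ includes $0$. For $n\in\mathbb{N}^+$, $[n]=\{1,\dots,n\}$. Let $(X,d)$ be a metric space. Length metric: the $d$-length of a $d$-continuous path $\gamma\colon[0,1]\to X$ is $L(\gamma)=\sup\sum_{k=1}^n d(\gamma(t_{k-1}),\gamma(t_k))$, the supremum being over all finite partitions $0=t_0<t_1<\dots<t_n=1$. The length metric induced by $d$ is $\bar d(p,q)=\inf\{L(\gamma): \gamma\colon[0,1]\to X \text{ is a } d\text{-continuous path joining } p \text{ to } q\}$, with $\inf\emptyset=\infty$. The metric $d_0$: for $\varepsilon>0$, an $\varepsilon$-chain joining $p$ to $q$ is a finite string $c=(x_0,\dots,x_n)$ of points of $X$ ($n\in\mathbb{N}^+$) with $x_0=p$, $x_n=q$ and $d(x_{k-1},x_k)\le\varepsilon$ for all $k\in[n]$; its length is $L(c)=\sum_{k=1}^n d(x_{k-1},x_k)$. Set $d_\varepsilon(p,q)=\inf\{L(c): c\text{ is an }\varepsilon\text{-chain joining } p\text{ to } q\}\in[0,\infty]$ and $d_0(p,q)=\sup_{\varepsilon>0}d_\varepsilon(p,q)=\lim_{\varepsilon\to0}d_\varepsilon(p,q)$. This is a metric on $X$ with values in $[0,\infty]$. Iterates: $d_0^0=d$ and $d_0^{n}=(d_0^{n-1})_0$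 for $n\in\mathbb{N}^+$, i.e., $d_0^n$ is obtained by applying the construction $\rho\mapsto\rho_0$ to the metric $\rho=d_0^{n-1}$. *)

(* Defs.v *)
From HB Require Import structures.
From mathcomp Require Import all_boot all_order all_algebra.
From mathcomp Require Import all_classical all_reals all_analysis.

Set Implicit Arguments.
Unset Strict Implicit.
Unset Printing Implicit Defensive.

Import Order.TTheory GRing.Theory Num.Theory.
Import numFieldNormedType.Exports.

Local Open Scope classical_set_scope.
Local Open Scope ring_scope.
Local Open Scope ereal_scope.

(* Metric spaces whose distance may be +oo: the [\bar R]-valued counterpart of
   [metricType].  [ballEemdist] says that the uniform structure (hence the
   topology) is the one of the metric.  The carrier may be empty. *)
HB.mixin Record PseudoMetric_isEMetric (R : realType) M & PseudoMetric R M := {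
  emdist : M -> M -> \bar R ;
  emdist_ge0 : forall x y, 0 <= emdist x y ;
  emdist_eq0 : forall x y, emdist x y = 0 <-> x = y ;
  emdist_sym : forall x y, emdist x y = emdist y x ;
  emdist_triangle : forall y x z, emdist x z <= emdist x y + emdist y z ;
  ballEemdist : forall x (e : R), ball x e = [set y | emdist x y < e%:E]
}.

#[short(type="emetricType")]
HB.structure Definition EMetric (R : realType) :=
  { M of PseudoMetric R M & PseudoMetric_isEMetric R M }.

(* Every extended metric gives rise to an [emetricType]. *)
HB.factory Record isEMetric (R : realType) (M : Type) & Choice M := {
  emdist : M -> M -> \bar R ;
  emdist_ge0 : forall x y, 0 <= emdist x y ;
  emdist_eq0 : forall x y, emdist x y = 0 <-> x = y ;
  emdist_sym : forall x y, emdist x y = emdist y x ;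
  emdist_triangle : forall y x z, emdist x z <= emdist x y + emdist y z
}.

HB.builders Context R M & isEMetric R M.

Let ball (x : M) (e : R) : set M := [set y | emdist x y < e%:E].

Let ent : set_system (M * M) := entourage_ ball.

Let nbhs (x : M) : set_system M := nbhs_ ent x.

Let nbhsE : nbhs = nbhs_ ent. Proof. by []. Qed.

HB.instance Definition _ := hasNbhs.Build M nbhs.

Let ball_center x (e : R) : (0 < e)%R -> ball x e x.
Proof.
by move=> e0; rewrite /ball/= (_ : emdist x x = 0) ?lte_fin//; apply/emdist_eq0.
Qed.

Let ball_sym x y (e : R) : ball x e y -> ball y e x.
Proof. by rewrite /ball/= emdist_sym. Qed.

Let ball_triangle x y z (e1 e2 : R) : ball x e1 y -> ball y e2 z ->
  ball x (e1 + e2)%R z.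
Proof.
rewrite /ball/= => xy yz.
by rewrite (le_lt_trans (emdist_triangle y _ _))// EFinD lteD.
Qed.

Let entourageE : ent = entourage_ ball. Proof. by []. Qed.

HB.instance Definition _ := @Nbhs_isPseudoMetric.Build R M
  ent nbhsE ball ball_center ball_sym ball_triangle entourageE.

Let ballEemdist x (e : R) :
  ball x e = [set y | emdist x y < e%:E].
Proof. by []. Qed.

HB.instance Definition _ := @PseudoMetric_isEMetric.Build R M
  emdist emdist_ge0 emdist_eq0 emdist_sym emdist_triangle ballEemdist.

HB.end.

(* Unlike [completeType], this does not require the carrier to be pointed. *)
Definition complete_space (T : uniformType) :=
  forall u : nat -> T, cauchy (u @ \oo) -> exists l : T, u @ \oo --> l.

(* A string (x_0, ..., x_n) is represented by its head x_0 and its tail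
   [:: x_1; ...; x_n], as in [path]. *)
Definition string_length (R : realType) (X : Type) (d : X -> X -> \bar R)
    (x : X) (s : seq X) : \bar R :=
  \sum_(0 <= k < size s) d (nth x (x :: s) k) (nth x (x :: s) k.+1).

Definition is_chain (R : realType) (X : Type) (d : X -> X -> \bar R)
    (e : R) (p q : X) (s : seq X) : Prop :=
  [/\ (0 < size s)%N, path (fun x y => d x y <= e%:E) p s & last p s = q].

Definition chain_dist_eps (R : realType) (X : Type) (d : X -> X -> \bar R)
    (e : R) (p q : X) : \bar R :=
  ereal_inf [set string_length d p s | s in is_chain d e p q].

(* The metric d_0 built from d; d is an arbitrary function so that the
   construction can be iterated with [iter]. *)
Definition chain_dist (R : realType) (X : Type) (d : X -> X -> \bar R)
    (p q : X) : \bar R :=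
  ereal_sup [set chain_dist_eps d e p q | e in [set e : R | (0 < e)%R]].

(* Paths are functions on the whole line of which only the restriction to
   [0, 1] matters; [itv_partition 0 1 s] says that 0 :: s is a strictly
   increasing sequence ending at 1. *)
Definition path_length (R : realType) (X : Type) (d : X -> X -> \bar R)
    (g : R -> X) : \bar R :=
  ereal_sup [set string_length d (g 0%R) (map g s) | s in itv_partition 0%R 1%R].

Definition is_path (R : realType) (X : topologicalType) (p q : X)
    (g : R -> X) : Prop :=
  [/\ {within `[0%R, 1%R], continuous g}, g 0%R = p & g 1%R = q].

Definition length_dist (R : realType) (X : emetricType R) (p q : X) : \bar R :=
  ereal_inf [set path_length (@emdist R X) g | g in is_path p q].

(* Main.v *)
(* Every iterate of the chain construction lies below the length metric: a
   rectifiable path can be cut into arcs of length at most e, and by induction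
   the iterates are bounded by arc length, so the cut points form a fine chain.
   Conversely a fixed point rho of the construction has approximate midpoints:
   if rho x y < C, some z satisfies rho x z < C/2 and rho z y < C/2.  Iterated
   bisection yields a C-Lipschitz map on the dyadic numbers, which extends to a
   path because d <= rho is complete. *)
Require Import Defs.
From mathcomp Require Import all_boot all_order all_algebra.
From mathcomp Require Import all_classical all_reals all_analysis.
From mathcomp Require Import ring lra.

Set Implicit Arguments.
Unset Strict Implicit.
Unset Printing Implicit Defensive.

Import Order.TTheory GRing.Theory Num.Theory.
Import numFieldNormedType.Exports.

(** * Chains and the chain distance *)

Section Chains.
Local Open Scope classical_set_scope.
Local Open Scope ring_scope.
Local Open Scope ereal_scope.
Context {R : realType} {X : Type}.
Implicit Types (d rho : X -> X -> \bar R) (p q x y z : X) (s t : seq X).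

Lemma string_length_nil d x : string_length d x [::] = 0.
Proof. by rewrite /string_length big_geq. Qed.

Lemma string_length_cons d x y s :
  string_length d x (y :: s) = d x y + string_length d y s.
Proof.
rewrite /string_length big_nat_recl//=; congr (_ + _).
apply: eq_big_nat => i /andP[_ ilt].
by rewrite !(@set_nth_default _ _ y x)//= ltnW.
Qed.

Lemma string_length_cat d x s t :
  (forall x y, 0 <= d x y) ->
  string_length d x (s ++ t) = string_length d x s + string_length d (last x s) t.
Proof.
move=> d0; elim: s x => [|y s IH] x /=; first by rewrite string_length_nil add0e.
by rewrite !string_length_cons IH addeA.
Qed.

Lemma le_string_length d rho x s :
  (forall x y, d x y <= rho x y) -> string_length d x s <= string_length rho x s.
Proof. by move=> drho; apply: lee_sum. Qed.

Lemma le_dist_string_length d x s :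
  (forall x, d x x = 0) -> (forall x y z, d x z <= d x y + d y z) ->
  d x (last x s) <= string_length d x s.
Proof.
move=> d0 dtri; elim: s x => [|y s IH] x /=; first by rewrite string_length_nil d0.
by rewrite string_length_cons (le_trans (dtri _ y _))// leeD2l.
Qed.

(** By the triangle inequality for [d], every chain is at least as long as [d x y], whatever its
    mesh; the mesh 1 serves as a witness for the supremum. *)
Lemma le_chain_dist d rho x y :
  (forall x, d x x = 0) -> (forall x y z, d x z <= d x y + d y z) ->
  (forall x y, d x y <= rho x y) -> d x y <= chain_dist rho x y.
Proof.
move=> d0 dtri drho; apply: le_ereal_sup_tmp.
exists (chain_dist_eps rho 1 x y); first by exists 1%R => //=.
apply: le_ereal_inf_tmp => _ [s [_ _ <-] <-].
exact: le_trans (le_dist_string_length _ _ d0 dtri) (le_string_length _ _ drho).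
Qed.

Lemma chain_distxx rho x : rho x x = 0 -> chain_dist rho x x <= 0.
Proof.
move=> rho0; apply: ge_ereal_sup => _ [e /= e0 <-].
(* A chain has at least one step, hence the chain (x, x). *)
apply: ereal_inf_lbound; exists [:: x].
  by split => //=; rewrite rho0 lee_fin ltW.
by rewrite string_length_cons string_length_nil rho0 adde0.
Qed.

(** At a fixed mesh [e], nearly shortest chains from [x] to [y] and from [y] to [z] are
    concatenated; the supremum over [e] is taken at the end. *)
Lemma chain_dist_triangle rho x y z : (forall x y, 0 <= rho x y) ->
  chain_dist rho x z <= chain_dist rho x y + chain_dist rho y z.
Proof.
move=> rho0; apply: ge_ereal_sup => _ [e /= e0 <-].
have sl0 u s : 0 <= string_length rho u s by apply: sume_ge0.
have ep u v : 0 <= chain_dist_eps rho e u v.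
  by apply: le_ereal_inf_tmp => _ [s _ <-].
have le_eps u v : chain_dist_eps rho e u v <= chain_dist rho u v.
  by apply: ereal_sup_ubound; exists e.
apply: le_trans (leeD (le_eps x y) (le_eps y z)).
apply/lee_addgt0Pr => eta eta0.
have [xyoo|/negbTE xyoo] := eqVneq (chain_dist_eps rho e x y) +oo.
  by rewrite xyoo addye ?addye ?leey// gt_eqF// (lt_le_trans _ (ep y z)).
have [yzoo|/negbTE yzoo] := eqVneq (chain_dist_eps rho e y z) +oo.
  by rewrite yzoo addey ?addye ?leey// gt_eqF// (lt_le_trans _ (ep x y)).
have eta20 : (0 < eta / 2)%R by rewrite divr_gt0.
have fin u v : (chain_dist_eps rho e u v == +oo) = false ->
    chain_dist_eps rho e u v \is a fin_num.
  by move=> h; rewrite ge0_fin_numE// ltey h.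
have [_ [s [s0 ps ls] <-] slt] := lb_ereal_inf_adherent eta20 (fin _ _ xyoo).
have [_ [t [t0 pt lt] <-] tlt] := lb_ereal_inf_adherent eta20 (fin _ _ yzoo).
apply: (@le_trans _ _ (string_length rho x (s ++ t))).
  apply: ereal_inf_lbound; exists (s ++ t) => //.
  by split; rewrite ?size_cat ?addn_gt0 ?s0// ?cat_path ?last_cat ls ?ps.
rewrite string_length_cat// ls (le_trans (leeD (ltW slt) (ltW tlt)))//.
by rewrite addeACA -EFinD -splitr.
Qed.

(** Walk along the chain while the budget [A] lasts, and let [z] be the vertex reached. If the next
    edge no longer fits, the unspent budget is below [e], so what remains of the chain is shorter
    than [B + e]. *)
Lemma chain_split rho (e A B : R) x s :
  (forall x, rho x x = 0) -> (forall x y z, rho x z <= rho x y + rho y z) ->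
  (forall x y, 0 <= rho x y) -> (0 <= A)%R -> (0 < B + e)%R ->
  path (fun x y => rho x y <= e%:E) x s ->
  string_length rho x s < (A + B)%:E ->
  exists2 z, rho x z <= A%:E & rho z (last x s) < (B + e)%:E.
Proof.
move=> rho0 tri ge0 + Be; elim: s x A => [|y s IH] x A A0 /=.
  by exists x; rewrite rho0// lte_fin.
move=> /andP[xye ps] lt; have [xyA|Axy] := leP (rho x y) A%:E; last first.
  exists x; first by rewrite rho0.
  apply: le_lt_trans (le_dist_string_length x (y :: s) rho0 tri) _.
  rewrite (lt_le_trans lt)// lee_fin addrC lerD2l -lee_fin.
  exact: le_trans (ltW Axy) xye.
have xyfin : rho x y \is a fin_num by rewrite ge0_fin_numE// (le_lt_trans xyA)// ltry.
move: lt xyA; rewrite string_length_cons -(fineK xyfin).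
rewrite -lteBrDl// -EFinB lee_fin => lt xyA.
have [||z yz zl] := IH y (A - fine (rho x y))%R _ ps.
- by rewrite subr_ge0.
- by rewrite addrAC.
exists z => //; rewrite (le_trans (tri _ y _))// -(fineK xyfin).
by rewrite -leeBrDl// -EFinB.
Qed.

Lemma chain_dist_midpoint rho (C : R) x y :
  (forall x, rho x x = 0) -> (forall x y z, rho x z <= rho x y + rho y z) ->
  (forall x y, 0 <= rho x y) -> chain_dist rho x y < C%:E ->
  exists2 z, rho x z < (C / 2)%:E & rho z y < (C / 2)%:E.
Proof.
move=> rho0 tri ge0 lt.
have c0 : 0 <= chain_dist rho x y.
  apply: le_ereal_sup_tmp; exists (chain_dist_eps rho 1 x y); first by exists 1%R => /=.
  by apply: le_ereal_inf_tmp => _ [s _ <-]; apply: sume_ge0.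
have cfin : chain_dist rho x y \is a fin_num by rewrite ge0_fin_numE// (lt_trans lt)// ltry.
move: c0 lt; rewrite -(fineK cfin) lee_fin lte_fin; set c := fine _ => c0 cC.
(* Some [e]-chain is shorter than (C + c) / 2. Splitting it with A = B = (C + c) / 4 gives A < C /
   2, and this [e] makes B + e exactly C / 2. *)
pose e := ((C - c) / 4)%R.
have e0 : (0 < e)%R by rewrite /e; lra.
have : chain_dist_eps rho e x y < (c + (C - c) / 2)%:E.
  apply: (@le_lt_trans _ _ c%:E); last by rewrite lte_fin; lra.
  by rewrite /c fineK//; apply: ereal_sup_ubound; exists e.
rewrite (_ : (c + (C - c) / 2) = (c + (C - c) / 2) / 2 + (c + (C - c) / 2) / 2)%R; last by lra.
move=> /ereal_inf_lt[_ [s [_ ps <-] <-]] slt.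
have [||z xz zy] := chain_split rho0 tri ge0 _ _ ps slt; rewrite /e; [lra..|].
exists z; [apply: le_lt_trans xz _|apply: lt_le_trans zy _].
  by rewrite lte_fin; lra.
by rewrite lee_fin /e; lra.
Qed.

End Chains.

(** * Arc length and the upper bound for the iterates *)

Section ArcLength.
Local Open Scope classical_set_scope.
Local Open Scope ring_scope.
Local Open Scope ereal_scope.
Context {R : realType} {X : emetricType R}.
Implicit Types (g : R -> X) (a b c e : R) (s t : seq R).

Let d : X -> X -> \bar R := @emdist R X.

Lemma emdistxx (x : X) : emdist x x = 0.
Proof. exact/emdist_eq0. Qed.

(** Variable endpoints allow paths to be cut; at 0 and 1 this is [path_length]. *)
Definition arc_length g a b : \bar R :=
  ereal_sup [set string_length d (g a) (map g s) | s in itv_partition a b].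

Lemma le_arc_length g a b s : itv_partition a b s ->
  string_length d (g a) (map g s) <= arc_length g a b.
Proof. by move=> abs; apply: ereal_sup_ubound; exists s. Qed.

Lemma arc_length_ge_dist g a b : (a < b)%R -> d (g a) (g b) <= arc_length g a b.
Proof.
move=> /itv_partition1/(le_arc_length g)/=.
by rewrite string_length_cons string_length_nil adde0.
Qed.

Lemma arc_length_ge0 g a b : (a < b)%R -> 0 <= arc_length g a b.
Proof. by move=> ab; rewrite (le_trans _ (arc_length_ge_dist g ab)) ?emdist_ge0. Qed.

(** Any partition of [b, c] can be appended to [s]. Keeping the left polygon fixed means that only
    one supremum is handled at a time. *)
Lemma le_arc_lengthD g a b c s : (b < c)%R -> itv_partition a b s ->
  string_length d (g a) (map g s) + arc_length g b c <= arc_length g a c.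
Proof.
move=> bc abs; have s_ge0 u (w : seq X) : 0 <= string_length d u w.
  by apply: sume_ge0 => i _; exact: emdist_ge0.
have [acoo|acoo] := eqVneq (arc_length g a c) +oo; first by rewrite acoo leey.
have abfin : string_length d (g a) (map g s) \is a fin_num.
  rewrite ge0_fin_numE// ltey; apply: contra acoo => /eqP aboo.
  have := le_arc_length g (itv_partition_cat abs (itv_partition1 bc)).
  rewrite map_cat string_length_cat ?aboo ?addye ?leye_eq//.
  - by rewrite gt_eqF// (lt_le_trans _ (s_ge0 _ _)).
  - exact: emdist_ge0.
rewrite addeC -leeBrDr//; apply: ge_ereal_sup => _ [t bct <-].
rewrite leeBrDr// addeC (le_trans _ (le_arc_length g (itv_partition_cat abs bct)))//.
rewrite map_cat string_length_cat; last exact: emdist_ge0.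
by rewrite last_map; case: abs => _ /eqP ->.
Qed.

Lemma arc_lengthD g a b c : (a < b)%R -> (b < c)%R ->
  arc_length g a b + arc_length g b c <= arc_length g a c.
Proof.
move=> ab bc.
have [bcoo|bcoo] := eqVneq (arc_length g b c) +oo.
  have := le_arc_lengthD g bc (itv_partition1 ab); rewrite bcoo.
  have ge0Ny (x : \bar R) : 0 <= x -> x != -oo by case: x.
  rewrite !addey// ge0Ny ?arc_length_ge0//.
  by apply: sume_ge0 => i _; exact: emdist_ge0.
have bcfin : arc_length g b c \is a fin_num.
  by rewrite ge0_fin_numE ?arc_length_ge0// ltey.
rewrite -leeBrDr//; apply: ge_ereal_sup => _ [s abs <-].
by rewrite leeBrDr//; exact: le_arc_lengthD.
Qed.

Lemma within_continuous_dist g (A : set R) x e : A x -> (0 < e)%R ->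
  {within A, continuous g} ->
  exists2 r : R, (0 < r)%R &
    forall y, A y -> (`|x - y| < r)%R -> d (g x) (g y) < e%:E.
Proof.
move=> Ax e0 /subspace_continuousP/(_ x Ax)/cvg_ballP/(_ e e0).
rewrite /within/= => /nbhs_ballP[r r0 xr]; exists r => // y Ay yr.
by have := xr y yr Ay; rewrite ballEemdist.
Qed.

(** Supremum argument: the set [S] of endpoints reachable by a fine partition contains its supremum
    [c], and continuity at [c] would extend it beyond [c] if c < b. *)
Lemma fine_partition g a b e : (a <= b)%R -> (0 < e)%R ->
  {within `[a, b], continuous g} ->
  exists2 s, itv_partition a b s & path (fun x y => d (g x) (g y) <= e%:E) a s.
Proof.
move=> ab e0 gc.
pose S := [set u | (a <= u <= b)%R /\ exists2 s, itv_partition a u s &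
                     path (fun x y => d (g x) (g y) <= e%:E) a s].
have Sa : S a by split; [rewrite lexx|exists [::] => //; split].
have supS : has_sup S by split; [exists a|exists b => u [/andP[]]].
pose c := sup S.
have ac : (a <= c)%R by apply: ub_le_sup => //; case: supS.
have cb : (c <= b)%R by apply: ge_sup; [exists a|move=> u [/andP[]]].
have e20 : (0 < e / 2)%R by rewrite divr_gt0.
have [|r r0 cr] := within_continuous_dist (x := c) _ e20 gc.
  by rewrite /= in_itv/= ac.
have [u [/andP[au ub] [s aus ps]] ucr] := sup_adherent r0 supS.
have uc : (u <= c)%R by apply: ub_le_sup; [by case: supS|split; [rewrite au|exists s]].
(* Both [g u] and [g v] lie within e / 2 of [g c], so the edge from [u] to [v] may be added. If v <=
   u, then u <= c <= v forces v = u. *)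
have ext v : (c <= v <= b)%R -> (v < c + r)%R -> S v.
  move=> /andP[cv vb] vr; split; first by rewrite (le_trans ac cv).
  have [uv|uv] := ltP u v; last first.
    by exists s; rewrite // (_ : v = u)//; apply/eqP; rewrite eq_le uv (le_trans uc).
  exists (s ++ [:: v]); first exact: itv_partition_cat aus (itv_partition1 uv).
  rewrite cat_path ps/= andbT; case: aus => _ /eqP ->.
  apply: le_trans (emdist_triangle (g c) _ _) _.
  rewrite (splitr e) EFinD emdist_sym ltW// lteD//; apply: cr.
  - by rewrite /= in_itv/= au.
  - by rewrite ger0_norm ?subr_ge0// ltrBlDl -ltrBlDr.
  - by rewrite /= in_itv/= vb (le_trans ac).
  - by rewrite ler0_norm ?subr_le0// opprB ltrBlDl.
suff cbE : c = b.
  by rewrite -cbE; have [] := ext c; rewrite ?lexx ?cb// ltrDl.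
apply/eqP; rewrite eq_le cb leNgt; apply/negP => {}cb.
have : (Num.min b (c + r / 2) <= c)%R.
  apply: ub_le_sup; [by case: supS|apply: ext].
    rewrite le_min (ltW cb) lerDl ge_min lexx/= andbT; lra.
  by rewrite gt_min orbC ltrD2l; apply/orP; left; lra.
by rewrite leNgt lt_min cb ltrDl divr_gt0.
Qed.

(** Each edge of [s] is subdivided by a fine partition; by the triangle inequality this cannot
    shorten the polygon. *)
Lemma refine_partition g a b e s : (0 < e)%R -> itv_partition a b s ->
  {within `[a, b], continuous g} ->
  exists s', [/\ itv_partition a b s',
    path (fun x y => d (g x) (g y) <= e%:E) a s' &
    string_length d (g a) (map g s) <= string_length d (g a) (map g s')].
Proof.
move=> e0; elim: s a => [|c s IH] a abs gc; first by exists [::].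
have cbs : itv_partition c b s by apply: itv_partition_cons abs.
have ac : (a < c)%R by case: abs => /= /andP[].
have cb := itv_partition_le cbs.
have [|s1 [cbs1 ps1 les1]] := IH c cbs.
  by apply: continuous_subspaceW gc; apply: subset_itvr; rewrite bnd_simp ltW.
have [|s2 acs2 ps2] := @fine_partition g a c e (ltW ac) e0.
  by apply: continuous_subspaceW gc; apply: subset_itvl; rewrite bnd_simp.
have [_ /eqP ls2] := acs2.
exists (s2 ++ s1); split; first exact: itv_partition_cat acs2 cbs1.
  by rewrite cat_path ps2 ls2.
rewrite map_cat string_length_cat; last exact: emdist_ge0.
rewrite last_map ls2 /= string_length_cons leeD//.
rewrite -{1}ls2 -last_map; apply: le_dist_string_length.
  exact: emdistxx.
by move=> *; exact: emdist_triangle.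
Qed.

(* Where the polygon [s] nearly exhausts the arc length, no single edge of [s]
   can miss much of it. *)
Lemma small_arcs g a b e s : itv_partition a b s ->
  arc_length g a b <= string_length d (g a) (map g s) + e%:E ->
  arc_length g a b < +oo -> (0 <= e)%R ->
  path (fun x y => d (g x) (g y) <= e%:E) a s ->
  path (fun x y => arc_length g x y <= (e + e)%:E) a s.
Proof.
move=> + + + e0; elim: s a => [//|c s IH] a abs /=.
have cbs : itv_partition c b s by apply: itv_partition_cons abs.
have ac : (a < c)%R by case: abs => /= /andP[].
have := itv_partition_le cbs; rewrite le_eqVlt => /predU1P[cbE|cb].
  move: cbs; rewrite -cbE => /itv_partitionxx -> /=.
  rewrite string_length_cons string_length_nil adde0 !andbT => le _ dle.
  by rewrite (le_trans le)// EFinD leeD2r.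
rewrite string_length_cons => le fin /andP[dle ps].
have acb := arc_lengthD g ac cb.
have ac_fin : arc_length g a c \is a fin_num.
  rewrite ge0_fin_numE ?arc_length_ge0// (le_lt_trans _ fin)// (le_trans _ acb)//.
  by rewrite leeDl// arc_length_ge0.
have cb_fin : arc_length g c b \is a fin_num.
  rewrite ge0_fin_numE ?arc_length_ge0// (le_lt_trans _ fin)// (le_trans _ acb)//.
  by rewrite leeDr// arc_length_ge0.
have d_fin : d (g a) (g c) \is a fin_num.
  by rewrite ge0_fin_numE ?emdist_ge0// (le_lt_trans dle)// ltry.
have s_le := le_arc_length g cbs.
have s_fin : string_length d (g c) (map g s) \is a fin_num.
  rewrite ge0_fin_numE ?(le_lt_trans s_le) ?ltey_eq ?cb_fin//.
  by apply: sume_ge0 => i _; exact: emdist_ge0.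
have d_le := arc_length_ge_dist g ac.
(* The gaps between arc and chord on [a, c], and between arc and polygon on [c, b], are nonnegative
   with sum at most [e]. Hence the first arc is at most its chord plus [e], and the second gap
   satisfies the hypothesis for the tail. *)
have := le_trans acb le.
move: d_le s_le dle.
rewrite -(fineK ac_fin) -(fineK cb_fin) -(fineK d_fin) -(fineK s_fin).
rewrite -!EFinD !lee_fin => d_le s_le dle sum_le.
apply/andP; split; first by lra.
apply: IH => //.
  by rewrite -(fineK cb_fin) -(fineK s_fin) -EFinD lee_fin; lra.
by rewrite -(fineK cb_fin) ltry.
Qed.


(** A polygon within e / 2 of the arc length is refined until its edges are at most e / 2; it stays
    nearly optimal, so [small_arcs] bounds its arcs by [e]. *)
Lemma small_arc_partition g a b e : (a < b)%R -> (0 < e)%R ->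
  {within `[a, b], continuous g} -> arc_length g a b < +oo ->
  exists2 s, itv_partition a b s & path (fun x y => arc_length g x y <= e%:E) a s.
Proof.
move=> ab e0 gc fin.
have e20 : (0 < e / 2)%R by rewrite divr_gt0.
have [|_ [s abs <-] lt] := ub_ereal_sup_adherent e20 (S := [set string_length d (g a) (map g s) | s in itv_partition a b]).
  by rewrite ge0_fin_numE// arc_length_ge0.
have [s' [abs' ps' le]] := refine_partition e20 abs gc.
exists s' => //; rewrite [e]splitr; apply: small_arcs (abs') _ _ _ ps' => //; last exact: ltW.
by rewrite -leeBlDr// (le_trans (ltW lt)).
Qed.

Lemma sum_arc_length (rho : X -> X -> \bar R) g a b s : (a < b)%R ->
  itv_partition a b s ->
  (forall u v, (a <= u)%R -> (u < v)%R -> (v <= b)%R -> rho (g u) (g v) <= arc_length g u v) ->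
  string_length rho (g a) (map g s) <= arc_length g a b.
Proof.
elim: s a => [|c s IH] a ab abs le_rho.
  by rewrite string_length_nil arc_length_ge0.
have cbs : itv_partition c b s by apply: itv_partition_cons abs.
have ac : (a < c)%R by case: abs => /= /andP[].
rewrite /= string_length_cons.
have := itv_partition_le cbs; rewrite le_eqVlt => /predU1P[cbE|cb].
  move: cbs; rewrite -cbE => /itv_partitionxx ->.
  by rewrite string_length_nil adde0 le_rho// cbE.
rewrite (le_trans _ (arc_lengthD g ac cb))// leeD// ?le_rho ?(ltW cb)//.
by apply: IH => // u v cu; apply: le_rho; rewrite (le_trans (ltW ac)).
Qed.

Lemma path_arc_length (rho : X -> X -> \bar R) g a b e s : itv_partition a b s ->
  (forall u v, (a <= u)%R -> (u < v)%R -> (v <= b)%R -> rho (g u) (g v) <= arc_length g u v) ->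
  path (fun x y => arc_length g x y <= e%:E) a s ->
  path (fun x y => rho (g x) (g y) <= e%:E) a s.
Proof.
elim: s a => [//|c s IH] a abs le_rho /= /andP[ace ps].
have cbs : itv_partition c b s by apply: itv_partition_cons abs.
have ac : (a < c)%R by case: abs => /= /andP[].
rewrite (le_trans (le_rho _ _ _ _ (itv_partition_le cbs)))//=.
by apply: IH => // u v cu; apply: le_rho; rewrite (le_trans (ltW ac)).
Qed.

(** Induction on [k], for all subintervals at once. Cut points bounding arcs of length at most [e]
    form an [e]-chain for the previous iterate, and superadditivity bounds its length by the whole
    arc. *)
Lemma iter_chain_dist_le_arc_length g a b k : (a < b)%R ->
  {within `[a, b], continuous g} ->
  iter k (@chain_dist R X) d (g a) (g b) <= arc_length g a b.
Proof.
elim: k a b => [|k IH] a b ab gc /=; first exact: arc_length_ge_dist.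
have [fin|] := ltP (arc_length g a b) +oo; last first.
  by rewrite leye_eq => /eqP ->; rewrite leey.
have {}IH u v : (a <= u)%R -> (u < v)%R -> (v <= b)%R ->
    iter k (@chain_dist R X) d (g u) (g v) <= arc_length g u v.
  move=> au uv vb; apply: IH => //; apply: continuous_subspaceW gc.
  by apply: subset_itv; rewrite bnd_simp.
apply: ge_ereal_sup => _ [e /= e0 <-].
have [s abs ps] := small_arc_partition ab e0 gc fin.
apply: (@le_trans _ _ (string_length (iter k (@chain_dist R X) d) (g a) (map g s))).
  apply: ereal_inf_lbound; exists (map g s) => //; split.
  (* An empty partition would force a = b. *)
  - rewrite size_map lt0n size_eq0; apply: contraTneq ab => s0.
    by move: abs; rewrite s0 => /itv_partition_nil ->; rewrite ltxx.
  - by rewrite path_map; exact: path_arc_length abs IH ps.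
  - by rewrite last_map; case: abs => _ /eqP ->.
exact: sum_arc_length.
Qed.

Lemma iter_chain_dist_le_length_dist k (p q : X) :
  iter k (@chain_dist R X) d p q <= length_dist p q.
Proof.
apply: le_ereal_inf_tmp => _ [g [gc <- <-] <-].
exact: iter_chain_dist_le_arc_length.
Qed.

End ArcLength.

(** * Iterated bisection along the dyadic numbers *)

Section DyadicPath.
Local Open Scope classical_set_scope.
Local Open Scope ring_scope.
Local Open Scope ereal_scope.
Context {R : realType} {X : emetricType R}.
Implicit Types (t u : R) (i k : nat).

(* Entry [k] of level [i] is the point at parameter [k / 2 ^ i]; the entries with
   [2 ^ i < k] are irrelevant and only spare a boundary case. *)
Fixpoint dyadic_net (mid : R -> X -> X -> X) (C : R) (p q : X) i k : X :=
  if i is i'.+1 then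
    let f := dyadic_net mid C p q i' in
    if odd k then mid (C / 2 ^+ i')%R (f k./2) (f k./2.+1) else f k./2
  else if k is 0%N then p else q.

Variables (mid : R -> X -> X -> X) (rho : X -> X -> \bar R) (C : R) (p q : X).
Hypothesis rho0 : forall x, rho x x = 0.
Hypothesis mid_lt : forall r x y, rho x y < r%:E ->
  rho x (mid r x y) < (r / 2)%:E /\ rho (mid r x y) y < (r / 2)%:E.
Hypothesis pqC : rho p q < C%:E.
Hypothesis C0 : (0 < C)%R.
Hypothesis le_rho : forall x y, emdist x y <= rho x y.

Let f := dyadic_net mid C p q.

Lemma dyadic_net_step i k : rho (f i k) (f i k.+1) < (C / 2 ^+ i)%:E.
Proof.
(* At level 0 all entries from 1 on equal [q], so only the first step is nontrivial. *)
elim: i k => [|i IH] k; first by rewrite expr0 divr1; case: k => //= k; rewrite rho0 lte_fin.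
have [h1 h2] := mid_lt (IH k./2).
have E : (C / 2 ^+ i.+1 = C / 2 ^+ i / 2)%R by rewrite exprSr invfM mulrA.
rewrite /f/= E uphalf_half; case: ifPn => ok /=; last by rewrite add0n; exact: h1.
by rewrite add1n; exact: h2.
Qed.

Lemma dyadic_net_refine i k :
  emdist (f i k./2) (f i.+1 k) <= (C / 2 ^+ i)%:E.
Proof.
rewrite /f/=; case: ifPn => ok.
  have [h1 _] := mid_lt (dyadic_net_step i k./2).
  rewrite (le_trans (le_rho _ _))// (le_trans (ltW h1))// lee_fin.
  have : (0 < C / 2 ^+ i)%R by rewrite divr_gt0// exprn_gt0.
  by lra.
by rewrite (_ : emdist _ _ = 0) ?lee_fin ?divr_ge0 ?exprn_ge0// ?ltW//; exact/emdist_eq0.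
Qed.

Lemma dyadic_net_dist i k l : emdist (f i k) (f i (k + l)) <= (C / 2 ^+ i *+ l)%:E.
Proof.
elim: l => [|l IH]; first by rewrite addn0 mulr0n (_ : emdist _ _ = 0)//; exact/emdist_eq0.
rewrite (le_trans (emdist_triangle (f i (k + l)) _ _))// mulrSr EFinD leeD//.
by rewrite addnS (le_trans (le_rho _ _))// ltW// dyadic_net_step.
Qed.

(** [t] is rounded down to a multiple of 1 / 2 ^ i. Truncation sends negative [t] to 0, so the
    approximants exist on the whole line. *)
Definition dyadic_approx t i : X := f i (Num.truncn (t * 2 ^+ i)%R).

Lemma dyadic_approx_step t i :
  emdist (dyadic_approx t i) (dyadic_approx t i.+1) <= (C / 2 ^+ i)%:E.
Proof.
(* Rounding down at level i + 1 and halving the index is rounding down at level i. *)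
rewrite /dyadic_approx (_ : Num.truncn (t * 2 ^+ i) = (Num.truncn (t * 2 ^+ i.+1))./2).
  exact: dyadic_net_refine.
have [t0|t0] := ltP t 0%R.
  suff T j : Num.truncn (t * 2 ^+ j) = 0%N by rewrite !T.
  by apply/truncn0Pn; rewrite -ltNge (@lt_trans _ _ 0%R)// nmulr_rlt0// exprn_gt0.
have tp j : (0 <= t * 2 ^+ j)%R by rewrite mulr_ge0// exprn_ge0.
apply: truncn_def.
have /andP[] := truncn_itv (tp i.+1); set m := Num.truncn _.
rewrite exprSr mulrA -{1 2}(odd_double_half m) -addnn -addSn !natrD -natr1.
have : (0 <= ((odd m)%:R : R) <= 1)%R by rewrite ler0n lern1 leq_b1.
set x := (t * _)%R. rewrite -natr1. lra.
Qed.

Lemma dyadic_approx_dist t i j :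
  emdist (dyadic_approx t i) (dyadic_approx t (i + j)) <= (2 * C / 2 ^+ i)%:E.
Proof.
(* The geometric sum is kept in exact form, so that the induction on [j] telescopes. *)
suff : emdist (dyadic_approx t i) (dyadic_approx t (i + j)) <=
    (2 * C / 2 ^+ i - 2 * C / 2 ^+ (i + j))%:E.
  move=> h; rewrite (le_trans h)// lee_fin gerBl divr_ge0 ?exprn_ge0//.
  by rewrite mulr_ge0// ltW.
elim: j => [|j IH].
  by rewrite addn0 subrr (_ : emdist _ _ = 0)//; exact/emdist_eq0.
rewrite (le_trans (emdist_triangle (dyadic_approx t (i + j)) _ _))//.
rewrite addnS (le_trans (leeD IH (dyadic_approx_step _ _)))//.
rewrite -EFinD lee_fin exprSr invfM.
by set x := (2 ^+ (i + j))^-1%R; set y := (2 ^+ i)^-1%R; lra.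
Qed.

Lemma near_dyadic_small (K e : R) : (0 < e)%R -> \forall i \near \oo, (K / 2 ^+ i < e)%R.
Proof.
move=> e0; near=> i.
have : (K / e < i%:R)%R by near: i; exact: nbhs_infty_gtr.
rewrite ltr_pdivrMr// => Ki; rewrite ltr_pdivrMr ?exprn_gt0// (lt_le_trans Ki)//.
by rewrite mulrC ler_pM2l// -natrX ler_nat ltnW// ltn_expl.
Unshelve. all: by end_near. Qed.

Lemma dyadic_approx_cauchy t : cauchy (dyadic_approx t @ \oo).
Proof.
apply: cauchy_exP => e e0.
have [i _ /(_ _ (leqnn i))/= ie] := near_dyadic_small (2 * C) e0.
exists (dyadic_approx t i); exists i => // j /= ij.
rewrite ballEemdist/= -(subnKC ij) (le_lt_trans (dyadic_approx_dist _ _ _))//.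
Qed.

(** The rounded indices differ by at most (u - t) 2 ^ i + 1, and each step costs at most C / 2 ^
    i. *)
Lemma dyadic_approx_lipschitz t u i : (t <= u)%R ->
  emdist (dyadic_approx t i) (dyadic_approx u i) <= (C * (u - t) + C / 2 ^+ i)%:E.
Proof.
move=> tu; rewrite /dyadic_approx.
have x0 : (0 < 2 ^+ i :> R)%R by rewrite exprn_gt0.
have le : (Num.truncn (t * 2 ^+ i) <= Num.truncn (u * 2 ^+ i))%N.
  by apply: le_truncn; rewrite ler_pM2r.
rewrite -(subnKC le) (le_trans (dyadic_net_dist _ _ _))// lee_fin -mulr_natr natrB//.
rewrite -[leRHS](_ : C / 2 ^+ i * ((u - t) * 2 ^+ i + 1) = _)%R; last first.
  by rewrite mulrDr mulr1 mulrACA [(_ * (u - t))%R]mulrC; congr (_ + _)%R; field; rewrite gt_eqF.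
rewrite ler_pM2l ?divr_gt0//.
have tS := truncnS_gt (t * 2 ^+ i)%R; rewrite -natr1 in tS.
have [u0|u0] := ltP u 0%R.
  rewrite [X in (X%:R - _)%R](_ : _ = 0%N); last first.
    by apply/truncn0Pn; rewrite -ltNge (@lt_trans _ _ 0%R)// nmulr_rlt0.
  have : (0 <= (u - t) * 2 ^+ i)%R by rewrite mulr_ge0 ?subr_ge0// ltW.
  have : (0 <= (Num.truncn (t * 2 ^+ i))%:R :> R)%R by [].
  by lra.
have /andP[uT _] := truncn_itv (mulr_ge0 u0 (ltW x0)).
lra.
Qed.

End DyadicPath.

(** * The limit path and the equality of the two metrics *)

Section DyadicLimit.
Local Open Scope classical_set_scope.
Local Open Scope ring_scope.
Local Open Scope ereal_scope.
Context {R : realType} {X : emetricType R}.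

Lemma path_length_lipschitz (g : R -> X) (C : R) :
  (forall t u, (t <= u)%R -> emdist (g t) (g u) <= (C * (u - t))%:E) ->
  path_length (@emdist R X) g <= C%:E.
Proof.
move=> lip; apply: ge_ereal_sup => _ [s [ps /eqP ls] <-].
(* The bound becomes [C] times the last point of [s] minus the first, a form in which the starting
   point can vary in the induction. *)
rewrite -[C]mulr1 -[1%R]subr0 -[X in (X - _)%R]ls.
elim: s 0%R {ls} ps => [|u s IH] t /=.
  by rewrite string_length_nil subrr mulr0.
move=> /andP[tu ps]; rewrite string_length_cons (le_trans (leeD (lip _ _ (ltW tu)) (IH _ ps)))//.
by rewrite -EFinD lee_fin -mulrDr addrC subrKA.
Qed.

(** For each [t] the dyadic approximants are Cauchy; their limits inherit the Lipschitz bound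
    because the rounding error C / 2 ^ i vanishes. *)
Lemma lipschitz_path (rho : X -> X -> \bar R) (C : R) (p q : X) :
  complete_space X ->
  (forall x, rho x x = 0) ->
  (forall r x y, rho x y < r%:E ->
     exists2 z, rho x z < (r / 2)%:E & rho z y < (r / 2)%:E) ->
  (forall x y, emdist x y <= rho x y) -> rho p q < C%:E ->
  exists g : R -> X, [/\ g 0%R = p, g 1%R = q &
    forall t u, (t <= u)%R -> emdist (g t) (g u) <= (C * (u - t))%:E].
Proof.
move=> cX rho0 rho_mid le_rho pqC.
have C0 : (0 < C)%R.
  by rewrite -lte_fin (le_lt_trans _ pqC)// (le_trans (emdist_ge0 p q)).
(* Midpoints are chosen as a total function of radius and endpoints, with the default [x] when no
   midpoint is promised. *)
have /choice[mid mid_lt] : forall w : R * X * X, exists z,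
    rho w.1.2 w.2 < w.1.1%:E ->
    rho w.1.2 z < (w.1.1 / 2)%:E /\ rho z w.2 < (w.1.1 / 2)%:E.
  move=> [[r x] y] /=; have [/rho_mid[z ? ?]|_] := ltP (rho x y) r%:E.
    by exists z.
  by exists x.
have {}mid_lt r x y := mid_lt (r, x, y); move: mid_lt => /=.
set m := (fun r x y => mid (r, x, y)) => mid_lt.
have {}mid_lt r x y : rho x y < r%:E ->
  rho x (m r x y) < (r / 2)%:E /\ rho (m r x y) y < (r / 2)%:E := mid_lt r x y.
pose a := dyadic_approx m C p q.
have [g ag] := choice (fun t => cX _ (dyadic_approx_cauchy rho0 mid_lt pqC C0 le_rho t)).
have gE t l : (forall i, a t i = l) -> g t = l.
  move=> atl; apply/esym/emdist_eq0/eqP; rewrite eq_le emdist_ge0 andbT.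
  apply/lee_addgt0Pr => e e0; rewrite add0e.
  have [i _ /(_ _ (leqnn i)) gi] := (cvg_ballP _ _).1 (ag t) e e0.
  have : ball (g t) e (a t i) by exact: gi.
  by rewrite atl ballEemdist/= emdist_sym => /ltW.
have a0 i : a 0%R i = p.
  by rewrite /a /dyadic_approx mul0r truncn0; elim: i.
have a1 i : a 1%R i = q.
  rewrite /a /dyadic_approx mul1r -natrX natrK; elim: i => //= i IH.
  by rewrite expnS mul2n odd_double doubleK.
exists g; split; [exact: gE|exact: gE|move=> t u tu].
(* One third of [e] goes to each of the two limits and one to the rounding error. *)
apply/lee_addgt0Pr => e e0; have e30 : (0 < e / 3)%R by rewrite divr_gt0.
near \oo => i.
have ti : emdist (g t) (a t i) < (e / 3)%:E.
  by near: i; move/cvg_ballP: (ag t) => /(_ _ e30); apply: filterS => j; rewrite ballEemdist.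
have ui : emdist (g u) (a u i) < (e / 3)%:E.
  by near: i; move/cvg_ballP: (ag u) => /(_ _ e30); apply: filterS => j; rewrite ballEemdist.
have Ci : (C / 2 ^+ i < e / 3)%R by near: i; exact: near_dyadic_small.
rewrite (le_trans (emdist_triangle (a t i) _ _))//.
apply: (@le_trans _ _ ((e / 3)%:E + ((C * (u - t) + C / 2 ^+ i)%:E + (e / 3)%:E))).
  apply: leeD; first exact: ltW.
  apply: le_trans (emdist_triangle (a u i) _ _) _; apply: leeD.
    exact: dyadic_approx_lipschitz rho0 mid_lt pqC C0 le_rho _ _ _ tu.
  by rewrite emdist_sym ltW.
by rewrite -!EFinD lee_fin; lra.
Unshelve. all: by end_near. Qed.

Lemma lipschitz_continuous (g : R -> X) (C : R) : (0 < C)%R ->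
  (forall t u, (t <= u)%R -> emdist (g t) (g u) <= (C * (u - t))%:E) ->
  continuous g.
Proof.
move=> C0 lip t; apply/cvg_ballP => e e0; apply/nbhs_ballP.
exists (e / C)%R; first by rewrite /= divr_gt0.
move=> u; rewrite /= ltr_pdivlMr// mulrC => tu.
rewrite ballEemdist/=; have [le|/ltW le] := leP t u.
  by rewrite (le_lt_trans (lip _ _ le))// lte_fin -[(u - t)%R]ger0_norm ?subr_ge0// distrC.
by rewrite emdist_sym (le_lt_trans (lip _ _ le))// lte_fin -[(t - u)%R]ger0_norm ?subr_ge0.
Qed.

End DyadicLimit.

Theorem proposition3p1 (R : realType) (X : emetricType R)
    (hX : complete_space X) (n : nat)
    (hn : iter n (@chain_dist R X) (@emdist R X) =
          iter n.+1 (@chain_dist R X) (@emdist R X))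
    (m : nat) (hm : (n <= m)%N) :
  iter m (@chain_dist R X) (@emdist R X) = @length_dist R X.
Proof.
apply/funext => p; apply/funext => q; apply/eqP; rewrite eq_le.
rewrite iter_chain_dist_le_length_dist/=.
(* Once two consecutive iterates agree, all later ones do. *)
have -> : iter m (@chain_dist R X) (@emdist R X) = iter n (@chain_dist R X) (@emdist R X).
  by rewrite -(subnK hm); elim: (m - n)%N => //= k ->; rewrite -iterS -hn.
have le_iter k x y : (emdist x y <= iter k (@chain_dist R X) (@emdist R X) x y)%E.
  elim: k x y => [//|k IH] x y.
  by apply: le_chain_dist IH => *; [exact: emdistxx|exact: emdist_triangle].
have iterxx k x : iter k (@chain_dist R X) (@emdist R X) x x = 0%E.
  elim: k => [|k IH]; first exact: emdistxx.
  by apply/eqP; rewrite eq_le chain_distxx//= (le_trans _ (le_iter k.+1 x x))// emdist_ge0.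
have {}hn : iter n (@chain_dist R X) (@emdist R X) =
    chain_dist (iter n (@chain_dist R X) (@emdist R X)) by rewrite -iterS.
move: (le_iter n) (iterxx n) hn; set rho := iter n _ _ => le_rho rho0 rhoE.
have rho_ge0 x y : (0 <= rho x y)%E by rewrite (le_trans _ (le_rho x y))// emdist_ge0.
have rho_tri x y z : (rho x z <= rho x y + rho y z)%E.
  (* As a fixed point, [rho] is itself a chain distance, so concatenation of chains applies to
     it. *)
  by rewrite rhoE; exact: chain_dist_triangle.
have [pqoo|] := eqVneq (rho p q) +oo%E; first by rewrite pqoo leey.
rewrite -ltey -ge0_fin_numE// => pqfin; apply/lee_addgt0Pr => e e0.
(* The slack [e] provides the strict inequality from which the bisection starts. *)
have pqC : (rho p q < (fine (rho p q) + e)%:E)%E.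
  by rewrite EFinD fineK// lteDl// lte_fin.
rewrite -(fineK pqfin) -EFinD; move: pqC; set C := (_ + _)%R => pqC.
have C0 : (0 < C)%R by rewrite -lte_fin (le_lt_trans (rho_ge0 p q)).
have [|g [g0 g1 lip]] := lipschitz_path hX rho0 _ le_rho pqC.
  by move=> r x y; rewrite {1}rhoE; exact: chain_dist_midpoint.
apply: le_trans (path_length_lipschitz lip); apply: ereal_inf_lbound.
exists g => //; split => //.
exact/continuous_subspaceT/(lipschitz_continuous C0 lip).
Qed.
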